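(* Let $A$ be an integral domain and $E$ an $A$-module. With $W(E)^{\#}$, $\operatorname{EC}(W(E)^{\#})$ and $U_a$ as defined in the context, the following hold. (i) $[a]\in U_a$ for every $a\in W(E)^{\#}$. (ii) For $a,b\in W(E)^{\#}$: $U_a\subseteq U_b$ if and only if $bE\subseteq aE$. In particular, if $a\mid b$ then $U_a\subseteq U_b$. (iii) $\bigcup_{a\in W(E)^{\#}}U_a=\operatorname{EC}(W(E)^{\#})$. (iv) If $[x]\in U_a\cap U_b$ for some $a,b\in W(E)^{\#}$, then $[x]\in U_x\subseteq U_a\cap U_b$. (v) If $A$ is a Bézout domain such that $\gcd(a,b)\in W(E)^{\#}$ for all $a,b\in W(E)^{\#}$, then $U_{\gcd(a,b)}=U_a\cap U_b$ for all $a,b\in W(E)^{\#}$. (vi) Assume $A$ is a GCD-domain such that $\operatorname{lcm}(a,b)\in W(E)^{\#}$ for all $a,b\in W(E)^{\#}$. If $a,b,c\in W(E)^{\#}$ satisfy $U_c\subseteq U_a$ and $U_c\subseteq U_b$, then $U_c\subseteq U_{\operatorname{lcm}(a,b)}$. (vii) Assume $E$ is a faithful multiplication module over a GCD-domain $A$ such that $\operatorname{lcm}(a,b)\in W(E)^{\#}$ for all $a,b\in W(E)^{\#}$. If $a,b,c\in W(E)^{\#}$ satisfy $U_a\subseteq U_c$ and $U_b\subseteq U_c$, then $U_{\operatorname{lcm}(a,b)}\subseteq U_c$.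
   Context: For an $A$-module $E$: $\operatorname{ann}(E)=\{a\in A: aE=0\}$, $W(E)=\{a\in A: aE\neq E\}$, $W(E)^{\#}=W(E)\setminus\operatorname{ann}(E)$. On $W(E)^{\#}$ put $a\sim b$ iff $aE=bE$; $[a]$ is the class of $a$ and $\operatorname{EC}(W(E)^{\#})$ is the set of all classes. For $a\in W(E)^{\#}$, $U_a=\{[b]\in\operatorname{EC}(W(E)^{\#}): aE\subseteq bE\}$. A domain is Bézout if the sum of two principal ideals is principal; it is a GCD-domain if any two nonzero elements have a gcd (hence also an lcm); gcd and lcm are determined up to units. $E$ is a multiplication module if every submodule of $E$ has the form $IE$ for some ideal $I$ of $A$; $E$ is faithful if $\operatorname{ann}(E)=0$. *)

(* Defs.v *)
From mathcomp Require Import all_boot all_algebra.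
From mathcomp Require Import boolp classical_sets.
Set Implicit Arguments.
Unset Strict Implicit.
Unset Printing Implicit Defensive.
Import GRing.Theory.
Local Open Scope classical_set_scope.
Local Open Scope ring_scope.

Section Domains.
Variable A : idomainType.
Implicit Types a b d m : A.

Definition divides a b : Prop := exists c, b = c * a.

(* In a domain gcds and lcms are only determined up to units, so they are
   predicates on the candidate d (resp. m) rather than functions of a and b. *)
Definition is_gcd d a b : Prop :=
  [/\ divides d a, divides d b
    & forall e, divides e a -> divides e b -> divides e d].

Definition is_lcm m a b : Prop :=
  [/\ divides a m, divides b m
    & forall e, divides a e -> divides b e -> divides m e].

Definition principal a : set A := range (fun x => a * x).

Definition bezout_domain : Prop :=
  forall a b, exists d,
    [set x + y | x in principal a & y in principal b] = principal d.

Definition gcd_domain : Prop :=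
  forall a b, a != 0 -> b != 0 -> exists d, is_gcd d a b.

End Domains.

Definition is_submodule (A : idomainType) (E : lmodType A) (N : set E) : Prop :=
  submod_closed (mem N).

(* Not idealr_closed, which excludes the unit ideal. *)
Definition is_ideal (A : idomainType) (I : set A) : Prop :=
  @is_submodule A A^o I.

Section Modules.
Variables (A : idomainType) (E : lmodType A).
Implicit Types a b : A.

Definition scaled a : set E := range (fun x : E => a *: x).

Definition ideal_mul (I : set A) : set E :=
  [set x | exists n (r : 'I_n -> A) (e : 'I_n -> E),
     (forall i, I (r i)) /\ x = \sum_(i < n) r i *: e i].

Definition multiplication_module : Prop :=
  forall N : set E, is_submodule N -> exists2 I, is_ideal I & N = ideal_mul I.

Definition ann : set A := [set a | scaled a = [set 0]].

Definition faithful_module : Prop := ann = [set 0].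

Definition W : set A := [set a | scaled a <> setT].

Definition Wsharp : set A := W `\` ann.

(* The class of a for the relation a ~ b <-> aE = bE on Wsharp, as a subset of
   Wsharp; it is only meaningful when a lies in Wsharp. *)
Definition class a : set A := [set b | Wsharp b /\ scaled a = scaled b].

Definition EC : set (set A) := [set class a | a in Wsharp].

Definition U a : set (set A) :=
  [set class b | b in [set b | Wsharp b /\ scaled a `<=` scaled b]].

End Modules.

Arguments scaled {A} E a.
Arguments ideal_mul {A} E I.
Arguments multiplication_module {A} E.
Arguments ann {A} E.
Arguments faithful_module {A} E.
Arguments W {A} E.
Arguments Wsharp {A} E.
Arguments class {A} E a.
Arguments EC {A} E.
Arguments U {A} E a.

(* Main.v *)
Require Import Defs.
From mathcomp Require Import all_boot all_algebra.
From mathcomp Require Import boolp classical_sets.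
Import GRing.Theory.
Local Open Scope classical_set_scope.
Local Open Scope ring_scope.

(** Writing [U E a] for the family of classes lying above [a E], everything
    except the last assertion is order theory.  A class determines the
    submodule [x E] of its representative, so [class E x] belongs to [U E a]
    exactly when [a E] is contained in [x E] ([U_class]).  Reflexivity and
    transitivity of inclusion then give (i)-(iv), and (vi) because [m E] is
    contained in [a E].  For (v), a Bezout relation [d = u a + v b] puts
    [d E] inside every submodule [x E] that contains both [a E] and [b E].

    For (vii) the point is that a faithful multiplication module over a domain
    detects divisibility: [c E] is contained in [a E] only if [a] divides [c]
    ([divides_of_scaled_sub]).  Granting this, the hypotheses say that [a] and
    [b] divide [c], hence so does their lcm [m], and [c E] is contained in
    [m E].

    To prove the cancellation, let [K] be the ideal of those [k] for which [a]
    divides [k c]; the goal is [1] in [K].  For each [e] write [A e = I E].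
    Faithfulness makes [E] torsion-free, and if [e != 0] and [r] is in [I], then
    [c e = a f] and [r f = s e] give [r c e = a s e], so [r c = a s] and [r] is
    in [K].  Thus every [x] lies in [K E].  Applying this inside [A e = I E] for
    one nonzero [e] gives [e] in [I K E = K I E = K e], so [e = k e] with [k] in
    [K], and [k = 1] by torsion-freeness. *)

(** * Classes and the sets U *)

Section UpSets.
Set Implicit Arguments.
Unset Strict Implicit.
Variables (A : idomainType) (E : lmodType A).
Implicit Types a b d m x : A.

Lemma class_scaled_eq x b :
  Wsharp E x -> class E x = class E b -> scaled E x = scaled E b.
Proof.
move=> Wx xb; have : class E x x by split.
by rewrite xb => -[_ ->].
Qed.

Lemma U_class a x :
  Wsharp E x -> U E a (class E x) <-> scaled E a `<=` scaled E x.
Proof.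
move=> Wx; split=> [[b [Wb ab] bx]|ax]; last by exists x.
by rewrite -(class_scaled_eq Wb bx).
Qed.

Lemma subset_U a b : scaled E b `<=` scaled E a -> U E a `<=` U E b.
Proof. by move=> ba _ [x [Wx ax] <-]; exists x => //; split=> // y /ba/ax. Qed.

Lemma subset_UE a b :
  Wsharp E a -> U E a `<=` U E b <-> scaled E b `<=` scaled E a.
Proof.
move=> Wa; split=> [ab|]; last exact: subset_U.
by apply/(U_class b Wa)/ab/U_class.
Qed.

Lemma divides_scaled_sub a b : divides a b -> scaled E b `<=` scaled E a.
Proof.
by move=> [c ->] _ [x _ <-]; exists (c *: x) => //; rewrite scalerA mulrC.
Qed.

Lemma scaled_comb_sub a b x u v :
  scaled E a `<=` scaled E x -> scaled E b `<=` scaled E x ->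
  scaled E (u * a + v * b) `<=` scaled E x.
Proof.
move=> ax bx _ [y _ <-].
have /ax[p _ pE] : scaled E a (a *: (u *: y)) by exists (u *: y).
have /bx[q _ qE] : scaled E b (b *: (v *: y)) by exists (v *: y).
exists (p + q) => //.
by rewrite scalerDr pE qE scalerDl !scalerA (mulrC a) (mulrC b).
Qed.

End UpSets.

(** The generator [g] of the ideal [a A + b A] is a common divisor of [a] and
    [b], so it divides [d], and a Bezout relation for [g] can be multiplied up
    to one for [d]. *)
Lemma bezout_gcd (A : idomainType) (a b d : A) :
  bezout_domain A -> is_gcd d a b -> exists u v, d = u * a + v * b.
Proof.
move=> bez [_ _ dmax]; have [g gE] := bez a b.
have genP z : principal g z -> divides g z.
  by move=> [y _ <-]; exists y; rewrite mulrC.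
have ga : divides g a.
  apply: genP; rewrite -gE; exists a; first by exists 1; rewrite ?mulr1.
  by exists 0; rewrite ?addr0 //; exists 0; rewrite ?mulr0.
have gb : divides g b.
  apply: genP; rewrite -gE; exists 0; first by exists 0; rewrite ?mulr0.
  by exists b; rewrite ?add0r //; exists 1; rewrite ?mulr1.
have : principal g g by exists 1; rewrite ?mulr1.
rewrite -gE => -[_ [u _ <-] [_ [v _ <-] uv]].
have [c ->] := dmax g ga gb; exists (c * u), (c * v).
by rewrite -uv mulrDr -!mulrA (mulrC u) (mulrC v).
Qed.

(** * Faithful multiplication modules over a domain *)

Section Multiplication.
Set Implicit Arguments.
Unset Strict Implicit.
Variables (A : idomainType) (E : lmodType A).
Implicit Types (a c r s : A) (e f x : E).

Lemma scale_comm r s e : r *: (s *: e) = s *: (r *: e).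
Proof. by rewrite !scalerA mulrC. Qed.

Lemma ideal_mul_ind (I : set A) (P : E -> Prop) :
  P 0 -> (forall x y, P x -> P y -> P (x + y)) ->
  (forall r x, I r -> P (r *: x)) -> forall x, ideal_mul E I x -> P x.
Proof.
by move=> P0 PD PZ _ [n [r [e [Ir ->]]]]; apply: big_ind => // i _; apply: PZ.
Qed.

Lemma cyclic_submodule e : is_submodule [set s *: e | s in [set: A]].
Proof.
split; first by rewrite inE; exists 0; rewrite ?scale0r.
move=> r _ _ /set_mem[s _ <-] /set_mem[t _ <-].
by rewrite inE; exists (r * s + t); rewrite ?scalerDl ?scalerA.
Qed.

(** The two halves of [A e = I E] in the form in which they are used. *)
Lemma cyclic_ideal_mul : multiplication_module E -> forall e,
  exists I : set A,
    ideal_mul E I e /\ forall r x, I r -> exists s, r *: x = s *: e.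
Proof.
move=> mulE e; have [I _ eI] := mulE _ (cyclic_submodule e).
exists I; split; first by rewrite -eI; exists 1; rewrite ?scale1r.
move=> r x Ir; have : ideal_mul E I (r *: x).
  exists 1, (fun=> r), (fun=> x); split=> //.
  by rewrite big_ord1.
by rewrite -eI => -[s _ <-]; exists s.
Qed.

Lemma faithful_eq0 r : faithful_module E -> (forall x, r *: x = 0) -> r = 0.
Proof.
move=> faithE r0; suff : ann E r by rewrite faithE.
apply/seteqP; split=> [_ [x _ <-]|_ ->]; first exact: r0.
by exists 0; rewrite ?scaler0.
Qed.

(** If [a e = 0] and [A e = I E], then [a I] annihilates [E]; so [a I = 0], and
    [I = 0] unless [a = 0]. *)
Lemma faithful_multiplication_torsion_free a e :
  faithful_module E -> multiplication_module E ->
  a *: e = 0 -> e <> 0 -> a = 0.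
Proof.
move=> faithE mulE ae0 e0; have [I [eI Ie]] := cyclic_ideal_mul mulE e.
apply: contrapT => /eqP a0; apply: e0.
apply: (ideal_mul_ind (P := fun x => x = 0) _ _ _ eI) =>
  [//|x y -> ->|r x Ir]; first by rewrite addr0.
suff -> : r = 0 by rewrite scale0r.
have /eqP : a * r = 0.
  apply: faithful_eq0 => // y; have [s rs] := Ie r y Ir.
  by rewrite -scalerA rs scale_comm ae0 scaler0.
by rewrite mulf_eq0 (negPf a0) => /eqP.
Qed.

Lemma scalerI_of_torsion_free r s e :
  faithful_module E -> multiplication_module E ->
  e <> 0 -> r *: e = s *: e -> r = s.
Proof.
move=> faithE mulE e0 rs; apply/eqP; rewrite -subr_eq0; apply/eqP.
apply: (faithful_multiplication_torsion_free faithE mulE _ e0).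
by rewrite scalerBl rs subrr.
Qed.

(** Cancellation of [E]: multiplying [E] by the conductor ideal [K] of [c]
    into [a A] does not shrink it, and then comparing both sides on one cyclic
    submodule forces [1] into [K]. *)
Lemma divides_of_scaled_sub a c :
  faithful_module E -> multiplication_module E ->
  scaled E c `<=` scaled E a -> divides a c.
Proof.
move=> faithE mulE ca.
have scaleI := scalerI_of_torsion_free faithE mulE.
pose K k := divides a (k * c).
have K0 : K 0 by exists 0; rewrite !mul0r.
have KD k l : K k -> K l -> K (k + l).
  by move=> [s ks] [t lt]; exists (s + t); rewrite !mulrDl ks lt.
have KM s k : K k -> K (s * k) by move=> [t kt]; exists (s * t); rewrite -!mulrA kt.
(* K E = E: for x != 0, writing A x = I E, torsion-freeness puts I inside K. *)
have EK x : ideal_mul E K x.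
  have [x0|x0] := pselect (x = 0).
    exists 0, (fun=> 0), (fun=> 0); split=> //.
    by rewrite big_ord0.
  have [I [[n [r [e [Ir xE]]]] Ix]] := cyclic_ideal_mul mulE x.
  exists n, r, e; split=> // i.
  have /ca[f _ af] : scaled E c (c *: x) by exists x.
  have [s rs] := Ix (r i) f (Ir i).
  exists s; apply: (scaleI _ _ x) => //.
  by rewrite -scalerA -af scale_comm rs scale_comm scalerA.
have [e e0] : exists e, e <> 0.
  apply: contrapT => noe; have /eqP : (1 : A) = 0.
    apply: faithful_eq0 => // x; apply: contrapT => x0; apply: noe.
    by exists x; rewrite -(scale1r x).
  by rewrite oner_eq0.
have [I [eI Ie]] := cyclic_ideal_mul mulE e.
pose Ke x := exists2 k, K k & x = k *: e.
have KeD x y : Ke x -> Ke y -> Ke (x + y).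
  move=> [k Kk ->] [l Kl ->]; exists (k + l); first exact: KD.
  by rewrite scalerDl.
have Ke0 : Ke 0 by exists 0; rewrite ?scale0r.
(* I E = I K E is contained in K (I E) = K e. *)
have IEKe r x : I r -> Ke (r *: x).
  move=> Ir; apply: (ideal_mul_ind (P := fun x => Ke (r *: x)) _ _ _ (EK x)).
  - by rewrite scaler0.
  - by move=> y z; rewrite scalerDr; apply: KeD.
  move=> k f Kk; have [s rs] := Ie r f Ir.
  exists (s * k); first exact: KM.
  by rewrite scale_comm rs scale_comm scalerA.
have [k Kk ek] : Ke e := ideal_mul_ind Ke0 KeD IEKe eI.
have k1 : 1 = k by apply: (scaleI _ _ e) => //; rewrite scale1r -ek.
by move: Kk; rewrite -k1 /K mul1r.
Qed.

End Multiplication.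

Theorem proposition1 (A : idomainType) (E : lmodType A) :
  (* (i) *)
  (forall a : A, Wsharp E a -> U E a (class E a)) /\
  (* (ii) *)
  ((forall a b : A, Wsharp E a -> Wsharp E b ->
      (U E a `<=` U E b <-> scaled E b `<=` scaled E a)) /\
   (forall a b : A, Wsharp E a -> Wsharp E b ->
      divides a b -> U E a `<=` U E b)) /\
  (* (iii) *)
  (\bigcup_(a in Wsharp E) U E a = EC E) /\
  (* (iv) *)
  (forall a b x : A, Wsharp E a -> Wsharp E b -> Wsharp E x ->
     (U E a `&` U E b) (class E x) ->
     U E x (class E x) /\ U E x `<=` U E a `&` U E b) /\
  (* (v) *)
  (bezout_domain A ->
   (forall a b d : A, Wsharp E a -> Wsharp E b -> is_gcd d a b ->
      Wsharp E d) ->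
   forall a b d : A, Wsharp E a -> Wsharp E b -> is_gcd d a b ->
     U E d = U E a `&` U E b) /\
  (* (vi) *)
  (gcd_domain A ->
   (forall a b m : A, Wsharp E a -> Wsharp E b -> is_lcm m a b ->
      Wsharp E m) ->
   forall a b c m : A, Wsharp E a -> Wsharp E b -> Wsharp E c ->
     is_lcm m a b ->
     U E c `<=` U E a -> U E c `<=` U E b -> U E c `<=` U E m) /\
  (* (vii) *)
  (faithful_module E -> multiplication_module E -> gcd_domain A ->
   (forall a b m : A, Wsharp E a -> Wsharp E b -> is_lcm m a b ->
      Wsharp E m) ->
   forall a b c m : A, Wsharp E a -> Wsharp E b -> Wsharp E c ->
     is_lcm m a b ->
     U E a `<=` U E c -> U E b `<=` U E c -> U E m `<=` U E c).
Proof.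
split; first by move=> a Wa; apply/U_class.
split.
  split=> a b Wa Wb; first exact: subset_UE.
  by move=> ab; apply/subset_U/divides_scaled_sub.
split.
  apply/seteqP; split=> [_ [a _ [x [Wx _] <-]]|_ [x Wx <-]]; exists x => //.
  exact/U_class.
split.
  move=> a b x _ _ Wx [/(U_class a Wx) ax /(U_class b Wx) bx].
  split; first exact/U_class.
  by move=> X xX; split; apply: subset_U xX.
split.
  move=> bez _ a b d _ _ gcd_d; have [da db _] := gcd_d.
  apply/seteqP; split=> [X dX|_ [[x [Wx ax] <-] /(U_class b Wx) bx]].
    by split; apply: subset_U dX; apply: divides_scaled_sub.
  have [u [v ->]] := bezout_gcd bez gcd_d.
  exact/(U_class _ Wx)/scaled_comb_sub.
split.
  move=> _ _ a b c m _ _ _ [am _ _] ca _; apply: (subset_trans ca).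
  exact/subset_U/divides_scaled_sub.
move=> faithE mulE _ _ a b c m Wa Wb _ [_ _ mmin].
move=> /(subset_UE c Wa) ca /(subset_UE c Wb) cb.
by apply/subset_U/divides_scaled_sub/mmin; apply: (divides_of_scaled_sub (E := E)).
Qed.
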